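(* Let $(X,d,a)$ be an O-metric space with O-metric $d:X\times X\to I_a$ and associated function $\mathbf{o}:I_a\times I_a\to\mathbb{R}_+$. Then each of the following is a topology on $X$: $$\mathcal{T}_1=\left\{A\subset X:\ \forall x\in A\ \exists r\in(\operatorname{Im}\mathbf{o})\setminus\{a\},\ B(x,|r-a|)\subset A\right\},$$ $$\mathcal{T}_2=\left\{A\subset X:\ \forall x\in A\ \exists r>0,\ B(x,r)\subset A\right\},$$ $$\mathcal{T}_3=\left\{A\subset X:\ \forall \{x_n\}\subset X,\ \bigl(d(x_n,x)\to a \text{ and } x\in A\bigr)\implies \exists n_0\in\mathbb{N}:\ x_n\in A\ \ \forall n\ge n_0\right\}.$$ Moreover $\mathcal{T}_1\subset\mathcal{T}_2=\mathcal{T}_3$.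
   Context: $\mathbb{R}_+=[0,\infty)$. Let $X$ be a non-empty set, $a\in\mathbb{R}_+$, $I_a\subset\mathbb{R}_+$ an interval containing $a$, and $\mathbf{o}:I_a\times I_a\to\mathbb{R}_+$ a function. A function $d:X\times X\to I_a$ is an O-metric on $X$, and $(X,d,a)$ is an O-metric space, if for all $x,y,z\in X$: (i) $d(x,y)=a$ if and only if $x=y$; (ii) $d(x,y)=d(y,x)$; (iii) $d(x,z)\le \mathbf{o}(d(x,y),d(y,z))$. $\operatorname{Im}\mathbf{o}=\{\mathbf{o}(u,v):u,v\in I_a\}$. For $x\in X$ and $r>0$, $B(x,r)=\{y\in X:|d(x,y)-a|<r\}$. In $\mathcal{T}_3$, the point $x$ ranges over $X$ and $\{x_n\}$ over sequences in $X$.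
   Formalization: That T_1 is a topology is stated only under the added assumption that (Im o)\{a} is non-empty; without it (e.g. X a point, a=0, o=0, d=0) X is not in T_1, so T_1 is not a topology. *)

(* Defs.v *)
From HB Require Import structures.
From mathcomp Require Import all_boot all_order all_algebra.
From mathcomp Require Import all_classical all_reals all_analysis.

Set Implicit Arguments.
Unset Strict Implicit.
Unset Printing Implicit Defensive.

Import Order.TTheory GRing.Theory Num.Theory.
Import numFieldNormedType.Exports.

Local Open Scope classical_set_scope.
Local Open Scope ring_scope.

Definition is_topology (X : Type) (T : set (set X)) : Prop :=
  [/\ T set0, T setT, setI_closed T &
      forall F : set (set X), F `<=` T -> T (\bigcup_(A in F) A)].

(* The function o : Ia x Ia -> [0, +oo) is represented by a total function
   whose values outside Ia x Ia are never used, and d : X x X -> Ia by a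
   real-valued function together with the field Ometric_mem. *)
Record is_Ometric (R : realType) (X : Type) (a : R) (Ia : set R)
    (o : R -> R -> R) (d : X -> X -> R) : Prop := IsOmetric {
  Ometric_mem : forall x y, Ia (d x y) ;
  Ometric_eq : forall x y, d x y = a <-> x = y ;
  Ometric_sym : forall x y, d x y = d y x ;
  Ometric_triangle : forall x y z, d x z <= o (d x y) (d y z) }.

Definition Im_o (R : realType) (Ia : set R) (o : R -> R -> R) : set R :=
  [set o u v | u in Ia & v in Ia].

Definition Oball (R : realType) (X : Type) (a : R) (d : X -> X -> R)
    (x : X) (r : R) : set X :=
  [set y | `|d x y - a| < r].

(* When X is nonempty, the whole space belongs to this family if and only if
   Im_o Ia o is not contained in {a}. *)
Definition Otop1 (R : realType) (X : Type) (a : R) (Ia : set R)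
    (o : R -> R -> R) (d : X -> X -> R) : set (set X) :=
  [set A | forall x, A x ->
     exists2 r, (Im_o Ia o `\ a) r & Oball a d x `|r - a| `<=` A].

Definition Otop2 (R : realType) (X : Type) (a : R) (d : X -> X -> R) :
    set (set X) :=
  [set A | forall x, A x -> exists2 r : R, 0 < r & Oball a d x r `<=` A].

Definition Otop3 (R : realType) (X : Type) (a : R) (d : X -> X -> R) :
    set (set X) :=
  [set A | forall (x_ : nat -> X) (x : X),
     (d (x_ n) x @[n --> \oo] --> a) /\ A x ->
     exists n0 : nat, forall n : nat, (n0 <= n)%N -> A (x_ n)].

(* Main.v *)
Require Import Defs.
From HB Require Import structures.
From mathcomp Require Import all_boot all_order all_algebra.
From mathcomp Require Import all_classical all_reals all_analysis.

Set Implicit Arguments.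
Unset Strict Implicit.
Unset Printing Implicit Defensive.

Import Order.TTheory GRing.Theory Num.Theory.
Import numFieldNormedType.Exports.

Local Open Scope classical_set_scope.
Local Open Scope ring_scope.

(** Balls about a fixed point are nested by radius, so asking each point of [A] for a ball inside
    [A], with radii from any nonempty family, defines a topology: [is_topology_Oball] gives T1 and
    T2. Since [r] differs from [a], the radii [|r - a|] are positive, hence T1 is contained in T2.
    The radii 1/(n+1) shrink to 0, so sequences detect the ball condition: T2 = T3, and T3 inherits
    the axioms from T2. *)

(* The radii are compared through [rho] alone, so one argument covers T1
   (radii |r - a| for r in Im o other than a) and T2 (all positive radii). *)
Lemma is_topology_Oball (R : realType) (X : Type) (a : R) (d : X -> X -> R)
    (S : set R) (rho : R -> R) :
  S !=set0 ->
  is_topology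
    [set A | forall x, A x -> exists2 r, S r & Oball a d x (rho r) `<=` A].
Proof.
move=> [r0 Sr0]; split.
- by [].
- by move=> x _; exists r0.
- move=> A B TA TB x [Ax Bx].
  have [r Sr rA] := TA x Ax; have [s Ss sB] := TB x Bx.
  (* The index giving the smaller radius serves both sets. *)
  have [rs|sr] := leP (rho r) (rho s).
  + exists r => // y xy; split; first exact: rA.
    exact/sB/(lt_le_trans xy).
  + exists s => // y xy; split; last exact: sB.
    exact/rA/(lt_trans xy).
- move=> F FT x [A FA Ax]; have [r Sr rA] := FT A FA x Ax.
  by exists r => // y xy; exists A => //; exact: rA.
Qed.

(** A ball about [x] catches a tail of the sequence. Symmetry enters because [Oball] measures
    [d x y], whereas convergence concerns [d (x_ n) x]. *)
Lemma Otop2_sub_Otop3 (R : realType) (X : Type) (a : R) (d : X -> X -> R) :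
  (forall x y, d x y = d y x) -> Otop2 a d `<=` Otop3 a d.
Proof.
move=> dC A TA x_ x [/cvgrPdist_lt xa Ax]; have [r r0 rA] := TA x Ax.
have [n0 _ n0P] := xa r r0; exists n0 => n n0n; apply: rA.
by rewrite /Oball /= dC distrC; exact: n0P.
Qed.

(* If no ball B(x, 1/(n+1)) lies in A, points of these balls outside A form a
   sequence converging to x that never enters A. *)
Lemma Otop3_sub_Otop2 (R : realType) (X : Type) (a : R) (d : X -> X -> R) :
  (forall x y, d x y = d y x) -> Otop3 a d `<=` Otop2 a d.
Proof.
move=> dC A TA x Ax; apply: contrapT => noball.
have /choice[x_ x_P] (n : nat) : exists y, Oball a d x n.+1%:R^-1 y /\ ~ A y.
  apply: contrapT => noy; apply: noball; exists n.+1%:R^-1 => // y xy.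
  by apply: contrapT => nAy; apply: noy; exists y.
have x_a : d (x_ n) x @[n --> \oo] --> a.
  apply/cvgrPdist_lt => e e0; near=> n.
  rewrite distrC dC; apply: lt_trans (x_P n).1 _.
  by near: n; exact: near_infty_natSinv_lt (PosNum e0).
have [n0 n0P] := TA x_ x (conj x_a Ax).
exact: (x_P n0).2 (n0P n0 (leqnn n0)).
Unshelve. all: by end_near. Qed.

Theorem proposition2p22 (R : realType) (X : Type) (a : R) (Ia : set R)
    (o : R -> R -> R) (d : X -> X -> R)
    (X_nonempty : inhabited X)
    (Ia_interval : is_interval Ia)
    (Ia_ge0 : forall u, Ia u -> 0 <= u)
    (Ia_a : Ia a)
    (o_ge0 : forall u v, Ia u -> Ia v -> 0 <= o u v)
    (d_Ometric : is_Ometric a Ia o d) :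
  [/\ (Im_o Ia o `\ a) !=set0 -> is_topology (Otop1 a Ia o d),
      is_topology (Otop2 a d),
      is_topology (Otop3 a d),
      Otop1 a Ia o d `<=` Otop2 a d &
      Otop2 a d = Otop3 a d].
Proof.
have dC := Ometric_sym d_Ometric.
have top2 : is_topology (Otop2 a d).
  by apply: (@is_topology_Oball _ _ a d [set r | 0 < r] id); exists 1 => /=.
have T23 : Otop2 a d = Otop3 a d.
  by apply/seteqP; split; [exact: Otop2_sub_Otop3|exact: Otop3_sub_Otop2].
split => //.
- exact: (@is_topology_Oball _ _ a d _ (fun r => `|r - a|)).
- by rewrite -T23.
- move=> A TA x Ax; have [r [_ /eqP ra] rA] := TA x Ax.
  by exists `|r - a| => //; rewrite normr_gt0 subr_eq0.
Qed.
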